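(* Let $a,b$ be positive integers and $n\in\mathbb{N}$. The distributive lattice $\mathcal{D}_n^{(a,b)}$ of Dyck-like paths of type $(a,b)$ and length $n\cdot\frac{a+b}{\gcd(a,b)}$ is isomorphic (as a poset) to the dual of the Young lattice $\mathcal{Y}_{\lambda_n^{(a,b)}}$ generated by the partition $\lambda_n^{(a,b)}$ associated with $\mathcal{D}_n^{(a,b)}$.
   Context: A Dyck-like path of type $(a,b)$ and length $N$ is a function $f:\{0,1,\ldots,N\}\to\mathbb{N}$ with $f(0)=f(N)=0$ and $f(k+1)-f(k)\in\{a,-b\}$ for all $0\le k<N$. Its up steps are $U=(1,a)$ and its down steps are $D=(1,-b)$. The set $\mathcal{D}_n^{(a,b)}$ consists of all such paths of length $n\cdot\ell(a,b)$, where $\ell(a,b)=\frac{a+b}{\gcd(a,b)}$, ordered by $f\le g$ iff $f(k)\le g(k)$ for every $k$; it is a finite distributive lattice. Put $g=\gcd(a,b)$. Every path in $\mathcal{D}_n^{(a,b)}$ has $nb/g$ up steps and $na/g$ down steps. Replace each up step by a unit north step $(0,1)$ and each down step by a unit east step $(1,0)$; this gives a lattice path from $(0,0)$ to $(na/g,\,nb/g)$. (Up to scaling this amounts to replacing $U,D$ by $(1,1),(1,-1)$ and rotating by $45^\circ$ anticlockwise.) The unit squares lying between the images of the maximum and the minimum path of $\mathcal{D}_n^{(a,b)}$ form a top- and left-justified array, i.e. a Ferrers diagram. The partition $\lambda_n^{(a,b)}$ associated with $\mathcal{D}_n^{(a,b)}$ is the partition whose parts are the (nonzero) numbers of squares in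 the rows of this diagram, read from the top row down. Partitions are ordered by: $(a_1,\ldots,a_h)\le(b_1,\ldots,b_k)$ iff $h\le k$ and $a_i\le b_i$ for $i=1,\ldots,h$ (containment of Ferrers diagrams). For a partition $\lambda$, the Young lattice $\mathcal{Y}_\lambda$ generated by $\lambda$ is the poset of all integer partitions $\alpha\le\lambda$ (including the empty one). *)

(* Defs.v *)
From HB Require Import structures.
From mathcomp Require Import all_boot all_order.
From mathcomp Require Import zify.

Set Implicit Arguments.
Unset Strict Implicit.
Unset Printing Implicit Defensive.

Import Order.TTheory.

(* The second disjunct is f(k+1) - f(k) = -b, written without truncated
   subtraction. Since k : 'I_N, both inord k and inord k.+1 are exact. *)
Definition is_dyck (a b N : nat) (f : {ffun 'I_N.+1 -> nat}) : bool :=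
  [&& f ord0 == 0, f ord_max == 0 &
      [forall k : 'I_N, (f (inord k.+1) == f (inord k) + a)
                     || (f (inord k.+1) + b == f (inord k))]].

Record dyck_path (a b N : nat) := DyckPath {
  height :> {ffun 'I_N.+1 -> nat};
  _ : is_dyck a b height
}.

HB.instance Definition _ a b N := [isSub for @height a b N].
HB.instance Definition _ a b N := [Choice of dyck_path a b N by <:].

Definition dyck_le (a b N : nat) (f g : dyck_path a b N) : bool :=
  [forall k, f k <= g k].

Section DyckLattice.
Variables a b N : nat.
Implicit Types f g h : dyck_path a b N.

Lemma dyck_leP f g : reflect (forall k, f k <= g k) (dyck_le f g).
Proof. exact: forallP. Qed.

Lemma dyck_ext f g : (forall k, f k = g k) -> f = g.
Proof. by move=> fg; apply/val_inj/ffunP. Qed.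

Lemma dyck_refl : reflexive (@dyck_le a b N).
Proof. by move=> f; apply/dyck_leP. Qed.

Lemma dyck_anti : antisymmetric (@dyck_le a b N).
Proof.
move=> f g /andP[/dyck_leP fg /dyck_leP gf].
by apply: dyck_ext => k; apply/eqP; rewrite eqn_leq fg gf.
Qed.

Lemma dyck_trans : transitive (@dyck_le a b N).
Proof.
move=> g f h /dyck_leP fg /dyck_leP gh.
by apply/dyck_leP => k; apply: leq_trans (gh k).
Qed.

Lemma dyck_start f : f (inord 0) = 0.
Proof.
case: f => f /= /and3P[/eqP f0 _ _]; rewrite -[RHS]f0.
by congr (f _); apply: val_inj; rewrite /= inordK.
Qed.

Lemma dyck_end f : f (inord N) = 0.
Proof.
case: f => f /= /and3P[_ /eqP fN _]; rewrite -[RHS]fN.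
by congr (f _); apply: val_inj; rewrite /= inordK.
Qed.

Lemma dyck_step f k : k < N ->
  (f (inord k.+1) = f (inord k) + a) \/ (f (inord k.+1) + b = f (inord k)).
Proof.
case: f => f /= /and3P[_ _ /forallP fS] kN.
by have /orP[/eqP|/eqP] := fS (Ordinal kN); [left | right].
Qed.

Lemma dyck_mod f k : k <= N -> f (inord k) = k * a %[mod a + b].
Proof.
elim: k => [|k IHk] kN; first by rewrite dyck_start.
have {IHk} /(_ (ltnW kN)) IHk := IHk; rewrite mulSn [a + k * a]addnC.
case: (dyck_step f kN) => [->|fS]; apply/eqP; first by rewrite eqn_modDr IHk.
by rewrite -(eqn_modDr b) fS -addnA modnDr IHk.
Qed.

Lemma dyck_gap f g k : k <= N -> f (inord k) < g (inord k) ->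
  f (inord k) + (a + b) <= g (inord k).
Proof.
move=> kN fg; have /eqP := etrans (dyck_mod g kN) (esym (dyck_mod f kN)).
rewrite (eqn_mod_dvd _ (ltnW fg)) => /dvdn_leq; lia.
Qed.

Lemma is_dyckI (F : {ffun 'I_N.+1 -> nat}) :
  F (inord 0) = 0 -> F (inord N) = 0 ->
  (forall k, k < N -> (F (inord k.+1) = F (inord k) + a)
                   \/ (F (inord k.+1) + b = F (inord k))) ->
  is_dyck a b F.
Proof.
move=> F0 FN FS; apply/and3P; split.
- by rewrite -F0; apply/eqP; congr (F _); apply: val_inj; rewrite /= inordK.
- by rewrite -FN; apply/eqP; congr (F _); apply: val_inj; rewrite /= inordK.
- by apply/forallP => k; case: (FS k (ltn_ord k)) => ->; rewrite eqxx ?orbT.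
Qed.

Fact dyck_meet_subproof f g :
  is_dyck a b [ffun k => minn (f k) (g k)].
Proof.
apply: is_dyckI => [||k kN]; rewrite !ffunE ?dyck_start ?dyck_end //.
have gapfg := @dyck_gap f g; have gapgf := @dyck_gap g f.
have := (gapfg k (ltnW kN), gapfg _ kN, (gapgf k (ltnW kN), gapgf _ kN)).
move=> [[h1 h2] [h3 h4]].
case: (dyck_step f kN) (dyck_step g kN) => [e1|e1] [e2|e2]; lia.
Qed.

Fact dyck_join_subproof f g :
  is_dyck a b [ffun k => maxn (f k) (g k)].
Proof.
apply: is_dyckI => [||k kN]; rewrite !ffunE ?dyck_start ?dyck_end //.
have gapfg := @dyck_gap f g; have gapgf := @dyck_gap g f.
have := (gapfg k (ltnW kN), gapfg _ kN, (gapgf k (ltnW kN), gapgf _ kN)).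
move=> [[h1 h2] [h3 h4]].
case: (dyck_step f kN) (dyck_step g kN) => [e1|e1] [e2|e2]; lia.
Qed.

Definition dyck_meet f g := DyckPath (dyck_meet_subproof f g).
Definition dyck_join f g := DyckPath (dyck_join_subproof f g).

Fact dyck_meetC : commutative dyck_meet.
Proof. by move=> f g; apply: dyck_ext => k; rewrite !ffunE minnC. Qed.
Fact dyck_joinC : commutative dyck_join.
Proof. by move=> f g; apply: dyck_ext => k; rewrite !ffunE maxnC. Qed.
Fact dyck_meetA : associative dyck_meet.
Proof. by move=> f g h; apply: dyck_ext => k; rewrite !ffunE minnA. Qed.
Fact dyck_joinA : associative dyck_join.
Proof. by move=> f g h; apply: dyck_ext => k; rewrite !ffunE maxnA. Qed.
Fact dyck_joinKI g f : dyck_meet f (dyck_join f g) = f.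
Proof. by apply: dyck_ext => k; rewrite !ffunE; lia. Qed.
Fact dyck_meetKU g f : dyck_join f (dyck_meet f g) = f.
Proof. by apply: dyck_ext => k; rewrite !ffunE; lia. Qed.
Fact dyck_meetUl : left_distributive dyck_meet dyck_join.
Proof. by move=> f g h; apply: dyck_ext => k; rewrite !ffunE minn_maxl. Qed.
Fact dyck_leEmeet f g : dyck_le f g = (dyck_meet f g == f).
Proof.
apply/dyck_leP/eqP => [fg|<- k]; last by rewrite ffunE geq_minr.
by apply: dyck_ext => k; rewrite ffunE; apply/minn_idPl.
Qed.

End DyckLattice.

HB.instance Definition _ a b N := Order.Le_isPOrder.Build (Order.Disp tt tt)
  (dyck_path a b N) (@dyck_refl a b N) (@dyck_anti a b N) (@dyck_trans a b N).
HB.instance Definition _ a b N := Order.POrder_Meet_isDistrLattice.Build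
  (Order.Disp tt tt) (dyck_path a b N)
  (@dyck_meetC a b N) (@dyck_joinC a b N) (@dyck_meetA a b N)
  (@dyck_joinA a b N) (@dyck_joinKI a b N) (@dyck_meetKU a b N)
  (@dyck_leEmeet a b N) (@dyck_meetUl a b N).

Definition ell (a b : nat) : nat := (a + b) %/ gcdn a b.

Definition dyck_lattice (a b n : nat) : Type := dyck_path a b (n * ell a b).

HB.instance Definition _ a b n :=
  Order.DistrLattice.on (dyck_lattice a b n).

(* The numbers of up and of down steps of a path in dyck_lattice a b n. *)
Definition nb_up (a b n : nat) : nat := n * (b %/ gcdn a b).
Definition nb_down (a b n : nat) : nat := n * (a %/ gcdn a b).

Section DyckBounds.
Variables a b n : nat.
Local Notation N := (n * ell a b).
Local Notation H := (nb_up a b n).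
Local Notation W := (nb_down a b n).

Lemma dyck_length : N = H + W.
Proof.
rewrite /ell /nb_up /nb_down -mulnDr [in RHS]addnC.
by rewrite divnDl // dvdn_gcdl.
Qed.

Lemma dyck_balance : H * a = W * b.
Proof.
rewrite /nb_up /nb_down -!mulnA; congr (n * _).
by rewrite mulnC muln_divCA_gcd mulnC.
Qed.

Fact dyck_bot_subproof :
  is_dyck a b ([ffun k : 'I_N.+1 => k * a %% (a + b)]).
Proof.
apply: is_dyckI => [||k kN]; rewrite !ffunE ?inordK //; first exact: mod0n.
- rewrite dyck_length mulnDl dyck_balance addnC -mulnDr; exact: modnMl.
- case: (posnP (a + b)) => [ab0|ab0].
    by left; rewrite ab0 !modn0 mulSn addnC.
  rewrite mulSn [a + k * a]addnC -modnDml; set r := k * a %% _.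
  have rlt : r < a + b by rewrite ltn_pmod.
  have [lt|ge] := ltnP (r + a) (a + b); first by left; rewrite modn_small.
  right; rewrite -(subnK ge) modnDr modn_small; lia.
- exact: ltnW.
Qed.

Fact dyck_top_subproof :
  is_dyck a b ([ffun k : 'I_N.+1 => minn (k * a) ((N - k) * b)]).
Proof.
have L := dyck_length; have B := dyck_balance.
apply: is_dyckI => [||k kN]; rewrite !ffunE ?inordK //; try lia.
- case: (ltnP k H) => kH; [left | right].
    have h1 : k.+1 * a <= H * a by rewrite leq_mul2r kH orbT.
    have h2 : W * b <= (N - k.+1) * b by rewrite leq_mul2r; lia.
    have h3 : W * b <= (N - k) * b by rewrite leq_mul2r; lia.
    nia.
  have h1 : H * a <= k * a by rewrite leq_mul2r kH orbT.
  have h2 : (N - k) * b <= W * b by rewrite leq_mul2r; lia.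
  have h3 : (N - k) * b = (N - k.+1) * b + b.
    by rewrite -[in LHS](@subnSK k) // mulSn addnC.
  nia.
Qed.

Definition dyck_bot : dyck_lattice a b n := DyckPath dyck_bot_subproof.
Definition dyck_top : dyck_lattice a b n := DyckPath dyck_top_subproof.

Fact dyck_le0x (f : dyck_lattice a b n) : (dyck_bot <= f)%O.
Proof.
apply/dyck_leP => k; rewrite ffunE -[in X in _ <= X](inord_val k).
rewrite -(@dyck_mod a b _ f); first exact: leq_mod.
by rewrite -ltnS.
Qed.

Fact dyck_lex1 (f : dyck_lattice a b n) : (f <= dyck_top)%O.
Proof.
apply/dyck_leP => k; rewrite ffunE -[in X in X <= _](inord_val k) leq_min.
have kN : k <= N by rewrite -ltnS.
apply/andP; split.
  elim: (nat_of_ord k) kN => [|j IHj] jN; first by rewrite dyck_start.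
  by have := IHj (ltnW jN); case: (dyck_step f jN); lia.
have: forall j, j <= N -> f (inord (N - j)) <= j * b.
  elim=> [|j IHj] jN; first by rewrite subn0 dyck_end.
  have lt : N - j.+1 < N by lia.
  have := IHj (ltnW jN); case: (dyck_step f lt); rewrite subnSK //; lia.
by move/(_ (N - k) (leq_subr _ _)); rewrite subKn.
Qed.

End DyckBounds.

HB.instance Definition _ a b n := Order.hasBottom.Build
  (Order.Disp tt tt) (dyck_lattice a b n) (@dyck_le0x a b n).
HB.instance Definition _ a b n := Order.hasTop.Build
  (Order.Disp tt tt) (dyck_lattice a b n) (@dyck_lex1 a b n).

Section PathImage.
Variables a b N : nat.
Implicit Type f : dyck_path a b N.

Definition up_step f k : bool := f (inord k.+1) == f (inord k) + a.

(* (easts f k, norths f k) is the k-th lattice point of the image of f when up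
   steps become (0,1) and down steps become (1,0). *)
Definition norths f k : nat := count (up_step f) (iota 0 k).
Definition easts f k : nat := count (predC (up_step f)) (iota 0 k).

(* Below, (i, j) stands for the unit square [i,i+1] x [j,j+1]; the image of a
   path crosses the column [i,i+1] in one east step, taken at height
   norths f k for the k with easts f k = i. *)
Definition square_below f i j : bool :=
  [exists k : 'I_N, [&& ~~ up_step f k, easts f k == i & j < norths f k]].
Definition square_above f i j : bool :=
  [exists k : 'I_N, [&& ~~ up_step f k, easts f k == i & norths f k <= j]].

End PathImage.

Definition is_intpart (s : seq nat) : bool := sorted geq s && (0 \notin s).

Record intpart := IntPart { parts :> seq nat; _ : is_intpart parts }.

HB.instance Definition _ := [isSub for parts].
HB.instance Definition _ := [Choice of intpart by <:].

Definition intpart_le (s t : intpart) : bool :=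
  (size s <= size t) && [forall i : 'I_(size s), nth 0 s i <= nth 0 t i].

Lemma intpart_leP (s t : intpart) :
  reflect (size s <= size t /\ forall i, i < size s -> nth 0 s i <= nth 0 t i)
          (intpart_le s t).
Proof.
apply: (iffP andP) => [[st /forallP le]|[st le]]; split=> //.
  by move=> i si; exact: (le (Ordinal si)).
by apply/forallP => i; exact: le.
Qed.

Fact intpart_refl : reflexive intpart_le.
Proof. by move=> s; apply/intpart_leP. Qed.

Fact intpart_anti : antisymmetric intpart_le.
Proof.
move=> s t /andP[/intpart_leP[sz_st st] /intpart_leP[sz_ts ts]].
have sz : size s = size t by apply/eqP; rewrite eqn_leq sz_st.
apply/val_inj/(@eq_from_nth _ 0) => // i si; apply/eqP.
by rewrite eqn_leq st // ts // -sz.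
Qed.

Fact intpart_trans : transitive intpart_le.
Proof.
move=> t s u /intpart_leP[sz_st st] /intpart_leP[sz_tu tu].
apply/intpart_leP; split=> [|i si]; first exact: leq_trans sz_tu.
by apply: leq_trans (st i si) (tu i _); apply: leq_trans sz_st.
Qed.

HB.instance Definition _ := Order.Le_isPOrder.Build (Order.Disp tt tt)
  intpart intpart_refl intpart_anti intpart_trans.

Definition young (lambda : intpart) : Type :=
  {alpha : intpart | (alpha <= lambda)%O}.

HB.instance Definition _ lambda := SubChoice.on (young lambda).
HB.instance Definition _ lambda :=
  [SubChoice_isSubPOrder of young lambda by <: with Order.Disp tt tt].

Section AssociatedPartition.
Variables a b n : nat.
Local Notation N := (n * ell a b).
Local Notation H := (nb_up a b n).
Local Notation W := (nb_down a b n).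

Definition square_between i j : bool :=
  square_below (\top%O : dyck_lattice a b n) i j
  && square_above (\bot%O : dyck_lattice a b n) i j.

Definition row_size j : nat := #|[set i : 'I_W | square_between i j]|.

(* Rows are read from the top (j = H - 1) down to the bottom (j = 0). *)
Definition dyck_rows : seq nat :=
  [seq l <- [seq row_size j | j <- rev (iota 0 H)] | 0 < l].

Lemma norths_top k : 0 < a -> 0 < b -> k <= N ->
  norths (\top%O : dyck_lattice a b n) k = minn k H.
Proof.
move=> a0 b0; rewrite /norths.
have L := dyck_length a b n; have B := dyck_balance a b n.
elim: k => [|k IHk] kN; first by rewrite min0n.
rewrite -[k.+1]addn1 iotaD count_cat IHk 1?ltnW //= addn0 add0n.
suff -> : up_step (\top%O : dyck_lattice a b n) k = (k < H) by lia.
rewrite /up_step !ffunE ?inordK //; last exact: ltnW.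
have [kH|kH] := ltnP k H.
  have h1 : k.+1 * a <= H * a by rewrite leq_mul2r kH orbT.
  have h2 : W * b <= (N - k.+1) * b by rewrite leq_mul2r; lia.
  have h3 : W * b <= (N - k) * b by rewrite leq_mul2r; lia.
  by apply/eqP; nia.
have h1 : H * a <= k * a by rewrite leq_mul2r kH orbT.
have h2 : (N - k) * b <= W * b by rewrite leq_mul2r; lia.
have h3 : (N - k) * b = (N - k.+1) * b + b.
  by rewrite -[in LHS](@subnSK k) // mulSn addnC.
by apply/negbTE/eqP; nia.
Qed.

Lemma row_size_mono j j' : j <= j' -> j' < H -> row_size j <= row_size j'.
Proof.
move=> jj' j'H.
have b0 : 0 < b by move: j'H; rewrite /nb_up; case: (b); rewrite ?div0n ?muln0.
apply/subset_leq_card/subsetP => i; rewrite !inE => /andP[].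
move=> /existsP[k /and3P[kd ki _]] /existsP[m /and3P[md mi mj]].
apply/andP; split; apply/existsP; last first.
  by exists m; rewrite md mi (leq_trans mj).
exists k; rewrite kd ki /=.
have a0 : 0 < a.
  have: 0 < W := leq_ltn_trans (leq0n i) (ltn_ord i).
  by rewrite /nb_down; case: (a) => //; rewrite div0n muln0.
have kN := ltn_ord k; rewrite norths_top ?(ltnW kN) //.
rewrite leq_min j'H andbT; apply: (leq_trans j'H).
rewrite leqNgt; apply/negP => kH; move: kd.
have := norths_top a0 b0 kN; rewrite /norths -addn1 iotaD count_cat.
rewrite -/(norths _ k) norths_top ?(ltnW kN) //= addn0 add0n.
by case: up_step => //; lia.
Qed.

Fact dyck_rows_subproof : is_intpart dyck_rows.
Proof.
rewrite /is_intpart mem_filter /= andbT.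
apply: sorted_filter; first by move=> x y z /= yx zy; apply: leq_trans zy yx.
have: all (ltn^~ H) (iota 0 H) by apply/allP => j; rewrite mem_iota.
rewrite map_rev rev_sorted sorted_map.
have := iota_sorted 0 H; move: (iota 0 H) => s.
case: s => //= j s; elim: s j => //= j' s IHs j /andP[jj' ps] /and3P[jH j'H sH].
by rewrite row_size_mono // IHs //= j'H.
Qed.

Definition dyck_partition : intpart := IntPart dyck_rows_subproof.

End AssociatedPartition.

(* Main.v *)
(* A path is determined by the numbers [row f j] of down steps preceding its
   j-th up step (0 <= j < H), that is, by the number of squares to the left of
   its image in each row.  These numbers increase weakly with j, and f <= g
   holds iff [row g j <= row f j] for all j, because [norths f k <= j] and
   [k <= row f j + j] are equivalent.  Conversely, a weakly increasing sequence
   bounded by the row lengths of the minimum path prescribes a path that lies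
   above the minimum path, hence stays nonnegative.  Read from the top row
   down, the row lengths of the minimum path form the associated partition. *)

Require Import Defs.
From mathcomp Require Import all_boot all_order.
From mathcomp Require Import zify.

Set Implicit Arguments.
Unset Strict Implicit.
Unset Printing Implicit Defensive.

Import Order.TTheory.

(** * Initial segments, and partitions padded with zeros *)

Lemma count_iota_downset (P : pred nat) n i :
  (forall x y, x <= y -> P y -> P x) -> i < n ->
  (i < count P (iota 0 n)) = P i.
Proof.
move=> Pdown lt_in; case Pi: (P i).
  rewrite -(subnKC lt_in) iotaD count_cat.
  have : all P (iota 0 i.+1).
    by apply/allP => x; rewrite mem_iota => /andP[_ xi]; apply: Pdown Pi; lia.
  by rewrite all_count => /eqP ->; rewrite size_iota leq_addr.
apply/negbTE; rewrite -leqNgt -(subnKC (ltnW lt_in)) iotaD count_cat.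
rewrite -[X in _ <= X]addn0 leq_add //.
  by rewrite -{2}(size_iota 0 i) count_size.
rewrite leqNgt -has_count; apply/hasPn => x; rewrite mem_iota => /andP[ix _].
by apply/negP => /(Pdown _ _ ix); rewrite Pi.
Qed.

Lemma count_ltn_iota c m : c <= m -> count (ltn^~ c) (iota 0 m) = c.
Proof.
move=> cm; rewrite -(subnKC cm) iotaD count_cat.
have : all (ltn^~ c) (iota 0 c) by apply/allP => i; rewrite mem_iota.
rewrite all_count => /eqP ->; rewrite size_iota -[RHS]addn0; congr (_ + _).
apply/eqP; rewrite -leqn0 leqNgt -has_count; apply/hasPn => i.
by rewrite mem_iota -leqNgt => /andP[].
Qed.

(** Sorting puts the zeros last, so deleting them only replaces stored zeros by default ones. *)
Lemma nth_filter_pos s i :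
  sorted geq s -> nth 0 [seq l <- s | 0 < l] i = nth 0 s i.
Proof.
have geq_trans : transitive geq by move=> x y z /= yx xz; apply: leq_trans yx.
elim: s i => //= x s IHs i xs.
have [x0|x_gt0] := posnP x; last first.
  by case: i => //= i; apply: IHs; apply: path_sorted xs.
have /allP s0 := order_path_min geq_trans xs; rewrite {x xs}x0 in s0 *.
have z y : y \in 0 :: s -> y = 0.
  by rewrite inE => /predU1P[//|/s0 /=]; rewrite leqn0 => /eqP.
have -> : [seq l <- s | 0 < l] = [::].
  rewrite -(filter_pred0 s); apply: eq_in_filter => y ys.
  by rewrite (z y) ?inE ?ys ?orbT.
rewrite nth_nil; have [lt|ge] := ltnP i (size (0 :: s)).
  by rewrite (z (nth 0 (0 :: s) i)) ?mem_nth.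
by rewrite nth_default.
Qed.

(** With default 0 the length condition is automatic: if [s] were longer than [t], its entry at
    index [size t] would be at most 0, but parts are nonzero. *)
Lemma intpart_le_nth (s t : intpart) :
  reflect (forall i, nth 0 s i <= nth 0 t i) (s <= t)%O.
Proof.
apply: (iffP (intpart_leP s t)) => [[_ st] i|st].
  by have [/st//|ge] := ltnP i (size s); rewrite nth_default.
split=> [|i _]; last exact: st.
rewrite leqNgt; apply/negP => lt_ts; have := st (size t).
rewrite [X in _ <= X]nth_default // leqn0 => /eqP s0.
have: 0 \notin (s : seq nat) by case: (s) => r /= /andP[].
by rewrite -s0 mem_nth.
Qed.

Lemma intpart_nth_le (s : intpart) i j : i <= j -> nth 0 s j <= nth 0 s i.
Proof.
move=> ij; have [lt|ge] := ltnP j (size s); last by rewrite nth_default.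
have s_sorted : sorted geq s by case: (s) => r /= /andP[].
have geq_trans : transitive geq by move=> x y z /= yx xz; apply: leq_trans yx.
have geq_refl : reflexive geq by move=> x /=.
apply: (sorted_leq_nth geq_trans geq_refl 0 s_sorted) => //.
by rewrite inE (leq_ltn_trans ij).
Qed.

Lemma intpart_eq_nth (s t : intpart) :
  (forall i, nth 0 s i = nth 0 t i) -> s = t.
Proof.
move=> st; apply: le_anti.
by apply/andP; split; apply/intpart_le_nth => i; rewrite st.
Qed.

(** * North and east steps along a path *)

Section Steps.
Variables a b N : nat.
Implicit Types (f : dyck_path a b N) (i j k : nat).

Lemma northsS f k : norths f k.+1 = norths f k + up_step f k.
Proof. by rewrite /norths -[k.+1]addn1 iotaD count_cat /= addn0 add0n. Qed.

Lemma eastsS f k : easts f k.+1 = easts f k + ~~ up_step f k.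
Proof. by rewrite /easts -[k.+1]addn1 iotaD count_cat /= addn0 add0n. Qed.

Lemma norths_easts f k : norths f k + easts f k = k.
Proof. by rewrite /norths /easts count_predC size_iota. Qed.

Lemma norths_le f i j : i <= j -> norths f i <= norths f j.
Proof. by move/subnKC <-; rewrite /norths iotaD count_cat leq_addr. Qed.

Lemma easts_le f i j : i <= j -> easts f i <= easts f j.
Proof. by move/subnKC <-; rewrite /easts iotaD count_cat leq_addr. Qed.

(** Discrete intermediate values: [easts f] starts at 0 and grows by at most 1 per step, only at
    down steps. *)
Lemma down_step_easts f m i : i < easts f m ->
  exists k, [/\ k < m, ~~ up_step f k & easts f k = i].
Proof.
elim: m => // m IHm; rewrite eastsS.
have [/IHm[k [km fk ki]] _|ge] := ltnP i (easts f m).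
  by exists k; split=> //; apply: ltnW.
case up: (up_step f m) => /= lt; first by lia.
by exists m; rewrite up; split=> //; lia.
Qed.

Hypothesis b_gt0 : 0 < b.

(** An up step changes the height by (a + b) - b, a down step by -b, so heights and north counts
    determine each other. Positivity of [b] keeps the two kinds of step apart. *)
Lemma norths_height f k : k <= N ->
  norths f k * (a + b) = f (inord k) + k * b.
Proof.
elim: k => [|k IHk] kN; first by rewrite dyck_start.
rewrite northsS mulnDl IHk 1?ltnW // /up_step.
by case: (dyck_step f kN) => fS; case: eqP => e; lia.
Qed.

Lemma dyck_le_norths (f g : dyck_path a b N) :
  reflect (forall k, k <= N -> norths f k <= norths g k) (f <= g)%O.
Proof.
apply: (iffP (dyck_leP f g)) => fg k.
  move=> kN; rewrite -(@leq_pmul2r (a + b)) ?ltn_addl //.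
  by rewrite !norths_height // leq_add2r.
have kN : k <= N by rewrite -ltnS.
rewrite -[k]inord_val -(leq_add2r (k * b)) -!norths_height //.
by rewrite leq_mul2r fg ?orbT.
Qed.

End Steps.

(** * Row lengths of a path and the order of paths *)

Section Rows.
Variables a b n : nat.
Hypotheses (a_gt0 : 0 < a) (b_gt0 : 0 < b).
Local Notation N := (n * ell a b).
Local Notation H := (nb_up a b n).
Local Notation W := (nb_down a b n).
Implicit Types (f g : dyck_lattice a b n) (i j k : nat).

Lemma norths_end f : norths f N = H.
Proof.
have := norths_height b_gt0 f (leqnn N).
have := dyck_length a b n; have := dyck_balance a b n.
rewrite dyck_end => B L e; apply/eqP.
rewrite -(@eqn_pmul2r (a + b)) ?ltn_addl // e add0n {1}L.
by apply/eqP; rewrite mulnDl -B mulnDr addnC.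
Qed.

Lemma easts_end f : easts f N = W.
Proof.
by have := norths_easts f N; have := dyck_length a b n; rewrite norths_end; lia.
Qed.

(** The positions counted form an initial segment; its last element is where the up step number [j]
    (from 0) starts, or [N] when [j >= H]. *)
Definition up_pos f j : nat :=
  (count (fun k => norths f k <= j) (iota 0 N.+1)).-1.

Definition row f j : nat := easts f (up_pos f j).

Lemma up_posP f j k : k <= N -> (k <= up_pos f j) = (norths f k <= j).
Proof.
move=> kN; rewrite /up_pos.
have down x y : x <= y -> norths f y <= j -> norths f x <= j.
  by move=> /(norths_le f); apply: leq_trans.
(* Position 0 is always counted, so the predecessor in [up_pos] is not truncated. *)
have := count_iota_downset down (isT : 0 < N.+1).
have := count_iota_downset down (kN : k < N.+1).
by case: count => [|c] <-.
Qed.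

Lemma up_pos_lt f j : j < H -> up_pos f j < N.
Proof. by move=> jH; rewrite ltnNge up_posP // norths_end -ltnNge. Qed.

(** The count is at most [j] here and exceeds [j] one step later, while a step adds at most 1. *)
Lemma norths_up_pos f j : j < H -> norths f (up_pos f j) = j.
Proof.
move=> jH; have ltN := up_pos_lt f jH.
have := up_posP f j ltN; have := up_posP f j (ltnW ltN).
by rewrite ltnn leqnn northsS; case: up_step; lia.
Qed.

Lemma row_up_pos f j : j < H -> row f j + j = up_pos f j.
Proof. by move=> /(norths_up_pos f) {2}<-; rewrite addnC norths_easts. Qed.

Lemma row_addn_lt f j : j < H -> row f j + j < N.
Proof. by move=> jH; rewrite row_up_pos // up_pos_lt. Qed.

Lemma norths_leE f j k : j < H -> k <= N ->
  (norths f k <= j) = (k <= row f j + j).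
Proof. by move=> jH kN; rewrite row_up_pos // up_posP. Qed.

Lemma row_unique f j c : j < H -> c + j <= N ->
  (forall k, k <= N -> (norths f k <= j) = (k <= c + j)) -> row f j = c.
Proof.
move=> jH cN fc; apply/eqP; rewrite -(eqn_add2r j) eqn_leq.
have rN := ltnW (row_addn_lt f jH).
apply/andP; split; first by rewrite -fc // norths_leE.
by rewrite -norths_leE // fc.
Qed.

Lemma row_le f i j : i <= j -> row f i <= row f j.
Proof.
move=> ij; apply: easts_le; rewrite /up_pos.
rewrite -!subn1 leq_sub2r //.
by apply: sub_count => k /= ki; apply: leq_trans ij.
Qed.

Lemma row_leW f j : j < H -> row f j <= W.
Proof. by move=> jH; rewrite -(easts_end f) easts_le // ltnW // up_pos_lt. Qed.

(** Both directions use [norths_leE]: one at position [row g j + j], the other in row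
    [norths g k]. *)
Lemma dyck_le_row f g :
  reflect (forall j, j < H -> row g j <= row f j) (f <= g)%O.
Proof.
apply: (iffP (dyck_le_norths b_gt0 f g)) => [fg j jH | fg k kN].
  have kN := ltnW (row_addn_lt g jH).
  rewrite -(leq_add2r j) -norths_leE //.
  by apply: leq_trans (fg _ kN) _; rewrite norths_leE.
have [jH|ge] := ltnP (norths g k) H; last first.
  by rewrite (leq_trans _ ge) // -(norths_end f) norths_le.
rewrite norths_leE //; apply: (@leq_trans (row g (norths g k) + norths g k)).
  by rewrite -norths_leE.
by rewrite leq_add2r fg.
Qed.

(** * The associated partition as the rows of the minimum path *)

Lemma square_below_top i j : i < W -> j < H ->
  square_below (\top%O : dyck_lattice a b n) i j.
Proof.
move=> iW jH; have L := dyck_length a b n.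
(* The maximum path makes all [H] north steps first, so it crosses column [i] at step [H + i], at
   height [H]. *)
have kN : H + i < N by lia.
have n1 := norths_top a_gt0 b_gt0 (ltnW kN).
have n2 := norths_top a_gt0 b_gt0 kN.
have ne := norths_easts (\top%O : dyck_lattice a b n) (H + i).
apply/existsP; exists (Ordinal kN) => /=; rewrite n1.
apply/and3P; split; last by lia.
  by move: n2; rewrite northsS n1; case: up_step => //; lia.
by apply/eqP; lia.
Qed.

Lemma square_above_row f i j : j < H -> square_above f i j = (i < row f j).
Proof.
move=> jH; apply/existsP/idP => [[k /and3P[fk /eqP <- kj]]|].
  have kN := ltn_ord k.
  (* Passing to the end of the east step makes the resulting bound on [easts] strict. *)
  have : norths f k.+1 <= j by rewrite northsS (negbTE fk) addn0.
  rewrite -up_posP // => /(easts_le f); rewrite eastsS fk addn1.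
  exact: leq_trans.
case/down_step_easts => k [km fk ki].
have kN := ltn_trans km (up_pos_lt f jH).
by exists (Ordinal kN); rewrite fk ki eqxx /= -up_posP ltnW // ltnW.
Qed.

(** The maximum path leaves the whole rectangle below it, so only the minimum path limits a row. *)
Lemma row_size_bot j : j < H -> row_size a b n j = row \bot%O j.
Proof.
move=> jH; rewrite /row_size.
under eq_finset => i do
  rewrite /square_between square_below_top // square_above_row //=.
rewrite -[RHS](@count_ltn_iota _ W) ?row_leW // -val_enum_ord count_map.
by rewrite cardsE cardE enumT /enum_mem size_filter.
Qed.

Definition row_seq f : seq nat := [seq row f j | j <- rev (iota 0 H)].

Lemma nth_row_seq f i :
  nth 0 (row_seq f) i = if i < H then row f (H - i.+1) else 0.
Proof.
case: ltnP => iH; last by rewrite nth_default // size_map size_rev size_iota.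
rewrite (nth_map 0) ?size_rev ?size_iota // nth_rev ?size_iota //.
by rewrite nth_iota // ltn_subrL (leq_ltn_trans _ iH).
Qed.

Lemma row_seq_sorted f : sorted geq (row_seq f).
Proof.
apply/(sortedP 0) => i; rewrite size_map size_rev size_iota => iH /=.
by rewrite !nth_row_seq iH (ltnW iH) row_le // leq_sub2l.
Qed.

Fact row_intpart_subproof f : is_intpart [seq l <- row_seq f | 0 < l].
Proof.
rewrite /is_intpart mem_filter andbT sorted_filter ?row_seq_sorted //.
by move=> x y z /= yx xz; apply: leq_trans yx.
Qed.

Definition row_intpart f : intpart := IntPart (row_intpart_subproof f).

Lemma nth_row_intpart f i :
  nth 0 (row_intpart f) i = if i < H then row f (H - i.+1) else 0.
Proof. by rewrite nth_filter_pos ?row_seq_sorted // nth_row_seq. Qed.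

Lemma row_intpart_bot : row_intpart \bot%O = dyck_partition a b n.
Proof.
apply: val_inj => /=; congr [seq l <- _ | 0 < l].
apply/eq_in_map => j; rewrite mem_rev mem_iota => /= jH.
by rewrite row_size_bot.
Qed.

Lemma row_intpart_le f g : (row_intpart g <= row_intpart f)%O = (f <= g)%O.
Proof.
apply/intpart_le_nth/dyck_le_row => [fg j jH | fg i].
  (* Reading rows from the top is the reflection of indices below [H], which is its own inverse. *)
  have [lt eq] : H - j.+1 < H /\ H - (H - j.+1).+1 = j by lia.
  by have := fg (H - j.+1); rewrite !nth_row_intpart lt eq.
by rewrite !nth_row_intpart; case: ltnP => // iH; apply: fg; lia.
Qed.

(** * Rebuilding a path from prescribed row lengths *)

Section PathOfRows.
Variable e : nat -> nat.
Hypothesis e_le : forall i j, i <= j -> e i <= e j.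
Hypothesis e_bot : forall j, j < H -> e j <= row \bot%O j.

(** Up step [j] of the desired path must start at [e j + j]; this counts those among the first [k]
    steps. *)
Definition rows_norths k : nat := count (fun j => e j + j < k) (iota 0 H).

Lemma rows_norths_leE j k : j < H -> (rows_norths k <= j) = (k <= e j + j).
Proof.
move=> jH; rewrite leqNgt [in RHS]leqNgt /rows_norths.
rewrite (@count_iota_downset (fun j => e j + j < k)) // => x y xy /=.
by have := e_le xy; lia.
Qed.

Lemma rows_norths_leH k : rows_norths k <= H.
Proof. by rewrite -[X in _ <= X](size_iota 0 H) count_size. Qed.

Lemma rows_norths_eq0 : rows_norths 0 = 0.
Proof. by rewrite /rows_norths (eq_count (a2 := pred0)) ?count_pred0. Qed.

Lemma rows_norths_end : rows_norths N = H.
Proof.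
apply/eqP; rewrite eqn_leq rows_norths_leH leqNgt; apply/negP => lt.
(* A missing up step would have to start at [N] or later, but the bound by the minimum path places
   it before [N]. *)
have := e_bot lt; have := row_addn_lt \bot%O lt.
by have := rows_norths_leE N lt; rewrite leqnn => /esym; lia.
Qed.

(** The starting positions [e j + j] are strictly increasing, so at most one up step starts at
    [k]. *)
Lemma rows_northsS k :
  rows_norths k.+1 = rows_norths k \/ rows_norths k.+1 = (rows_norths k).+1.
Proof.
suff: rows_norths k <= rows_norths k.+1 <= (rows_norths k).+1 by lia.
apply/andP; split; first by apply: sub_count => j /=; apply: ltnW.
have [lt|ge] := ltnP (rows_norths k).+1 H; last first.
  exact: leq_trans (rows_norths_leH _) ge.
rewrite rows_norths_leE //.
have := rows_norths_leE k (ltnW lt); rewrite leqnn => /esym.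
by have := e_le (leqnSn (rows_norths k)); lia.
Qed.

(** The prescribed counts dominate those of the minimum path, whose heights are natural numbers. *)
Lemma rows_norths_above k : k <= N -> k * b <= rows_norths k * (a + b).
Proof.
move=> kN; pose bot : dyck_lattice a b n := \bot%O.
apply: (@leq_trans (norths bot k * (a + b))).
  by rewrite norths_height // leq_addl.
rewrite leq_mul2r; apply/orP; right.
have [lt|ge] := ltnP (rows_norths k) H; last first.
  by rewrite (leq_trans _ ge) // -(norths_end \bot%O) norths_le.
rewrite norths_leE //.
apply: (@leq_trans (e (rows_norths k) + rows_norths k)).
  by rewrite -rows_norths_leE.
by rewrite leq_add2r e_bot.
Qed.

(** The formula solves [norths_height] for the height; [rows_norths_above] makes the subtraction
    exact. *)
Fact rows_path_subproof :
  is_dyck a b [ffun k : 'I_N.+1 => rows_norths k * (a + b) - k * b].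
Proof.
apply: is_dyckI => [||k kN]; rewrite !ffunE ?inordK //; last exact: ltnW.
- by rewrite rows_norths_eq0.
- rewrite rows_norths_end dyck_length mulnDl mulnDr dyck_balance.
  by rewrite addnC subnn.
have := rows_norths_above (ltnW kN); have := rows_norths_above kN.
by case: (rows_northsS k) => ->; [right | left]; lia.
Qed.

Definition rows_path : dyck_lattice a b n := DyckPath rows_path_subproof.

Lemma norths_rows_path k : k <= N -> norths rows_path k = rows_norths k.
Proof.
move=> kN; apply/eqP; rewrite -(@eqn_pmul2r (a + b)) ?ltn_addl //.
by rewrite norths_height // ffunE inordK // subnK // rows_norths_above.
Qed.

Lemma row_rows_path j : j < H -> row rows_path j = e j.
Proof.
move=> jH; apply: row_unique => // [|k kN].
  by have := e_bot jH; have := row_addn_lt \bot%O jH; lia.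
by rewrite norths_rows_path // rows_norths_leE.
Qed.

End PathOfRows.

(** * The isomorphism *)

Lemma row_intpart_surj (s : intpart) :
  (s <= dyck_partition a b n)%O -> exists f, row_intpart f = s.
Proof.
rewrite -row_intpart_bot => /intpart_le_nth s_le.
pose e j := nth 0 s (H - j.+1).
have e_le i j : i <= j -> e i <= e j by move=> ij; apply: intpart_nth_le; lia.
have e_bot j : j < H -> e j <= row \bot%O j.
  move=> jH; have [lt eq] : H - j.+1 < H /\ H - (H - j.+1).+1 = j by lia.
  by have := s_le (H - j.+1); rewrite nth_row_intpart lt eq.
exists (rows_path e_le e_bot); apply: intpart_eq_nth => i.
rewrite nth_row_intpart; case: ltnP => iH.
  rewrite row_rows_path; last by lia.
  by congr (nth 0 s _); lia.
(* From index [H] on, the partition of the minimum path is padded with 0, which forces [s] to vanish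
   there. *)
have := s_le i; rewrite nth_row_intpart ltnNge iH /=; lia.
Qed.

End Rows.

Theorem proposition3p3 (a b n : nat) (ha : 0 < a) (hb : 0 < b) :
  exists2 phi : dyck_lattice a b n -> ((young (dyck_partition a b n))^d)%type,
    bijective phi & {mono phi : f g / (f <= g)%O}.
Proof.
have le_lambda (f : dyck_lattice a b n) :
    (row_intpart f <= dyck_partition a b n)%O.
  by rewrite -row_intpart_bot // row_intpart_le // le0x.
pose phi f : (young (dyck_partition a b n))^d%type :=
  (exist _ (row_intpart f) (le_lambda f) : young (dyck_partition a b n)).
have phi_mono : {mono phi : f g / (f <= g)%O}.
  (* The order on the dual of the subtype unfolds to reversed containment of the underlying
     partitions. *)
  by move=> f g; exact: row_intpart_le.
exists phi => //.
have phi_surj (y : young (dyck_partition a b n)) : exists f, phi f == y.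
  case: y => s s_le; have [f fs] := row_intpart_surj ha hb s_le.
  by exists f; apply/eqP/val_inj.
pose psi y := xchoose (phi_surj y).
have psiK : cancel psi phi by move=> y; apply/eqP/(xchooseP (phi_surj y)).
exists psi => // f.
(* An order embedding is injective, so the chosen right inverse is also a left inverse. *)
by apply: (inc_inj phi_mono); rewrite psiK.
Qed.
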